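(* Algorithm Online_SumFj (described in the context) is 2-competitive for the online problem $1|jrp,s=1,p_j=1,r_j|\sum F_j+c_\mathcal{Q}$; that is, on every instance the cost of the solution it produces is at most twice the optimal offline cost.
   Context: Problem $1|jrp,s=1,p_j=1,r_j|\sum F_j+c_\mathcal{Q}$: jobs with processing time $1$ and nonnegative integer release dates $r_j$ must be processed non-preemptively on a single machine (at most one job at a time). There is a single resource, required by every job; each replenishment of it costs $K:=K_0+K_1\ge0$. A solution consists of start times $S_j$ (completion times $C_j=S_j+1$) and replenishment times $t_1<\dots<t_q$; it is feasible if no two jobs overlap and for each job $j$ some replenishment time lies in $[r_j,S_j]$. Its cost is $\sum_jF_j+qK$, where $F_j=C_j-r_j$. Online setting: jobs are not known in advance (neither their number nor their data); a job becomes known at its release date. Time proceeds in integer steps; at each time $t$ the algorithm first learns the jobs released at $t$, then decides whether to replenish at $t$, then may start jobs; decisions cannot be revoked. An online algorithm is $c$-competitive if on every instance its cost is at most $c$ times the optimal offline cost. Let $G(a)=a(a+1)/2$. Algorithm Online_SumFj: start with $t:=0$. Repeat: let $B_t$ be the set of jobs released by time $t$ that are not yet scheduled; if $\sum_{j\in B_t}(t-r_j)+G(|B_t|)\ge K$, then replenish the resource at $t$, start the jobs of $B_t$ consecutively from time $t$ without idle time in increasing release date order, and set $t:=t+|B_t|$; otherwise set $t:=t+1$.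
   Formalization: The algorithm's test is applied only when B_t is nonempty; for K > 0 this changes nothing, but for K = 0 the algorithm as literally described would, with B_t empty, replenish and set t := t + 0 forever. *)

(* Defs.v *)
From HB Require Import structures.
From mathcomp Require Export all_boot all_order all_algebra.
From mathcomp Require Export classical_sets reals.

Set Implicit Arguments.
Unset Strict Implicit.
Unset Printing Implicit Defensive.

Import Order.TTheory GRing.Theory Num.Theory.
Local Open Scope ring_scope.

(* An instance is the number n of jobs with their release dates r : 'I_n -> nat.
   Offline solutions may use arbitrary real start and replenishment times. *)

Record solution (R : realType) (n : nat) := Solution {
  start : 'I_n -> R;
  replenishments : seq R
}.

Definition feasible (R : realType) (n : nat) (r : 'I_n -> nat)
    (s : solution R n) : Prop :=
  [/\ sorted <%R (replenishments s),
      forall i j : 'I_n, i != j ->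
        start s i + 1 <= start s j \/ start s j + 1 <= start s i
    & forall j : 'I_n, exists2 t : R,
        t \in replenishments s & (r j)%:R <= t <= start s j].

Definition completion (R : realType) (n : nat) (s : solution R n) (j : 'I_n) : R :=
  start s j + 1.

Definition flow_time (R : realType) (n : nat) (r : 'I_n -> nat)
    (s : solution R n) (j : 'I_n) : R :=
  completion s j - (r j)%:R.

Definition cost (R : realType) (K : R) (n : nat) (r : 'I_n -> nat)
    (s : solution R n) : R :=
  \sum_(j < n) flow_time r s j + (size (replenishments s))%:R * K.

Definition opt_cost (R : realType) (K : R) (n : nat) (r : 'I_n -> nat) : R :=
  inf [set cost K r s | s in [set s : solution R n | feasible r s]]%classic.

(* What has been decided strictly before time [clock]: the pairs (job, start
   time) and the replenishment times. *)
Record log := Log {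
  clock : nat;
  started : seq (nat * nat);
  replenished : seq nat
}.

(* Whenever the machine is free, an online algorithm is given the pairs
   (job, release date) of the jobs released by time [clock], and its log; it
   answers whether to replenish now, and which jobs (possibly none) to start
   consecutively from now on.  It is consulted again when these jobs are
   completed, or at the next integer time if it starts none. *)
Definition online_algorithm := seq (nat * nat) -> log -> bool * seq nat.

Definition released (n : nat) (r : 'I_n -> nat) (t : nat) : seq (nat * nat) :=
  [seq (val j, r j) | j <- enum 'I_n & (r j <= t)%N].

Definition advance (A : online_algorithm) (n : nat) (r : 'I_n -> nat)
    (L : log) : log :=
  let t := clock L in
  let d := A (released r t) L in
  Log (t + maxn 1 (size d.2))
      (started L ++ zip d.2 (iota t (size d.2)))
      (if d.1 then rcons (replenished L) t else replenished L).

Definition run (A : online_algorithm) (n : nat) (r : 'I_n -> nat) (k : nat) : log :=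
  iter k (advance A r) (Log 0 [::] [::]).

Definition complete (n : nat) (L : log) : Prop :=
  forall j : 'I_n, val j \in unzip1 (started L).

(* From iteration k on, nothing is started or replenished any more, so that the
   k-th log holds the whole solution. *)
Definition settled (A : online_algorithm) (n : nat) (r : 'I_n -> nat) (k : nat) : Prop :=
  forall m : nat, (k <= m)%N ->
    started (run A r m) = started (run A r k) /\
    replenished (run A r m) = replenished (run A r k).

(* Meaningful for complete logs only: a job that is not started gets 0. *)
Definition solution_of (R : realType) (n : nat) (L : log) : solution R n :=
  Solution
    (fun j : 'I_n =>
      (nth 0%N (unzip2 (started L)) (index (val j) (unzip1 (started L))))%:R)
    [seq t%:R | t <- replenished L].

Definition produces (R : realType) (A : online_algorithm) (n : nat)
    (r : 'I_n -> nat) (s : solution R n) : Prop :=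
  exists k : nat,
    [/\ settled A r k, complete n (run A r k) & s = solution_of R n (run A r k)].

Definition competitive (R : realType) (K c : R) (A : online_algorithm) : Prop :=
  forall (n : nat) (r : 'I_n -> nat),
    exists s : solution R n,
      [/\ produces A r s, feasible r s & cost K r s <= c * opt_cost K r].

Definition G (R : realType) (a : R) : R := a * (a + 1) / 2.

Definition backlog (known : seq (nat * nat)) (L : log) : seq (nat * nat) :=
  [seq j <- known | j.1 \notin unzip1 (started L)].

(* The test B != [::] only matters when K = 0: without it the empty backlog
   would satisfy the condition 0 >= K and the clock would advance by 0 forever.
   The sort is stable, so that ties are broken by job number. *)
Definition Online_SumFj (R : realType) (K : R) : online_algorithm :=
  fun known L =>
    let t := clock L in
    let B := backlog known L in
    if (B != [::]) &&
       (K <= \sum_(j <- B) (t%:R - j.2%:R) + G (size B)%:R)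
    then (true, unzip1 (sort (fun i j => (i.2 <= j.2)%N) B))
    else (false, [::]).

(* Main.v *)
(** Let the algorithm replenish at [t], let [B] be the batch started there, [f]
    its total flow time, and [w] the successor of the previous replenishment
    time.  Reassign the starts of an offline solution to the jobs in the order
    of release; let [O] be its flow time on [B] and [m] the number of its
    replenishments in [[w, t + 1)].  It suffices that [f + K <= 2 O + 2 m K] for
    every batch.
    - If [m = 0], then [O >= f >= K].
    - If the machine was busy until [t], then the offline solution is at most
      [p] jobs ahead, with [p ^ 2 <= K], so that [f <= O + p |B|].  Its
      replenishments split [B] into [m + 1] groups, and a group of [d] jobs has
      flow time at least [G d >= p d - K / 2].
    - Otherwise the backlog at [t - 1] was too small, which bounds [f] from
      above by [K] plus the contribution of the jobs released at [t]; the
      remaining cross term is absorbed by [2 x y <= x ^ 2 + y ^ 2].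
    The lead [p] is created while the algorithm waits: [p] jobs that the offline
    solution started before [t] were released at times that make the backlog at
    [t - 1] cost at least [G (p - 1) + G p = p ^ 2], and it cannot grow while
    the machine is busy. *)

From mathcomp Require Import ring lra zify.
Require Import Defs.

Set Implicit Arguments.
Unset Strict Implicit.
Unset Printing Implicit Defensive.

Import Order.TTheory GRing.Theory Num.Theory.
Local Open Scope ring_scope.

(** * One batch against an offline schedule *)

Section Batch.
Variable R : realType.
Implicit Types (K : R) (l : seq R) (rho : nat -> nat) (sigma : nat -> R).

Lemma sum_succ (d : nat) : \sum_(i < d) (i%:R + 1 : R) = G d%:R.
Proof.
elim: d => [|d IH]; first by rewrite big_ord0 /G !mul0r.
by rewrite big_ord_recr /= IH /G -natr1; field.
Qed.

Lemma G_le_sum (d : nat) (phi : nat -> R) :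
  (forall i, (i < d)%N -> i%:R + 1 <= phi i) -> G d%:R <= \sum_(i < d) phi i.
Proof. by move=> h; rewrite -sum_succ; apply: ler_sum => i _; apply: h. Qed.

Lemma G_ge0 (d : nat) : 0 <= G d%:R :> R.
Proof. by rewrite -sum_succ; apply: sumr_ge0 => i _; rewrite addr_ge0. Qed.

Lemma antitone_prefix (P : pred nat) (d : nat) :
  (forall i j, (i <= j < d)%N -> P j -> P i) ->
  exists2 y, (y <= d)%N & forall i, (i < d)%N -> P i = (i < y)%N.
Proof.
elim: d => [|d IH] anti; first by exists 0%N.
case Pd: (P d).
  exists d.+1 => // i id; rewrite id; apply: (anti i d) => //.
  by rewrite -ltnS id /=.
have [|y yd Py] := IH.
  by move=> i j /andP[ij jd]; apply: anti; rewrite ij ltnW.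
exists y => [|i]; first exact: leqW.
rewrite ltnS leq_eqVlt => /orP[/eqP ->|/Py //].
by rewrite Pd; apply/esym/negbTE; rewrite -leqNgt.
Qed.

Lemma sum_ord_addn (a d : nat) (F : nat -> R) :
  \sum_(i < a + d) F i = \sum_(i < a) F i + \sum_(i < d) F (a + i)%N.
Proof. by rewrite big_split_ord. Qed.

(** At position [i] of a list of jobs in release order, [rho i] is the release date and [sigma i]
    the reassigned offline start. This is disjointness of unit jobs, summed over consecutive
    starts. *)
Definition spaced (d : nat) sigma :=
  forall i j, (i <= j < d)%N -> sigma i + (j - i)%:R <= sigma j.

Definition nondecreasing_upto (d : nat) rho :=
  forall i j, (i <= j < d)%N -> (rho i <= rho j)%N.

(** [l] collects the offline replenishments of the window ending before [t + 1]; of a job served by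
    a later one only the bound on its start is kept. *)
Definition served_from l (t d : nat) rho sigma :=
  forall i, (i < d)%N ->
    (exists2 tau, tau \in l & (rho i)%:R <= tau <= sigma i) \/ t%:R + 1 <= sigma i.

Lemma spaced_shift a d sigma :
  spaced (a + d) sigma -> spaced d (fun i => sigma (a + i)%N).
Proof.
move=> sp i j /andP[ij jd].
by rewrite -(subnDl a); apply: sp; rewrite leq_add2l ltn_add2l ij.
Qed.

Lemma spaced_sub a d sigma : (a <= d)%N -> spaced d sigma -> spaced a sigma.
Proof. by move=> ad sp i j /andP[ij ja]; apply: sp; rewrite ij (leq_trans ja). Qed.

Lemma spaced_ge d sigma (theta : R) :
  spaced d sigma -> ((0 < d)%N -> theta <= sigma 0%N) ->
  forall i, (i < d)%N -> theta + i%:R <= sigma i.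
Proof.
move=> sp h i id; have /h h0 : (0 < d)%N by apply: leq_trans id.
by have := sp 0%N i; rewrite id subn0 => /(_ isT); lra.
Qed.

(** The start at position [i] is at least [sigma 0 + i], when all jobs have already waited [i]. *)
Lemma flow_ge_G d rho sigma :
  spaced d sigma -> (forall i, (i < d)%N -> (rho i)%:R <= sigma 0%N) ->
  G d%:R <= \sum_(i < d) (sigma i + 1 - (rho i)%:R).
Proof.
move=> sp h; apply: (@G_le_sum d (fun i => sigma i + 1 - (rho i)%:R)) => i id.
have := spaced_ge sp (fun _ => lexx _) id; have := h i id; lra.
Qed.

Lemma served_ge_G t d rho sigma :
  (forall i, (i < d)%N -> (rho i <= t)%N) -> spaced d sigma ->
  ((0 < d)%N -> t%:R <= sigma 0%N) ->
  G d%:R <= \sum_(i < d) (sigma i + 1 - (rho i)%:R).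
Proof.
move=> rt sp h; apply: flow_ge_G => // i id.
apply: le_trans (h _); last exact: leq_trans id.
by rewrite ler_nat rt.
Qed.

(* The jobs split into one group per replenishment of [l] and a last group; a
   group of [d] jobs has flow time at least [G d], and [p d <= K / 2 + G d]. *)
Lemma lead_le_flow K (p t : nat) l d rho sigma :
  p%:R ^+ 2 <= K -> sorted <%R l -> nondecreasing_upto d rho -> spaced d sigma ->
  (forall i, (i < d)%N -> (rho i <= t)%N) -> served_from l t d rho sigma ->
  p%:R * d%:R <= ((size l)%:R + 1) * K / 2
                 + \sum_(i < d) (sigma i + 1 - (rho i)%:R).
Proof.
(* From [2 p y <= p ^ 2 + y ^ 2], [p ^ 2 <= K] and [y ^ 2 / 2 <= G y]. *)
move=> pK; have young (y : nat) : p%:R * y%:R <= K / 2 + G y%:R.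
  have : 0 <= (p%:R - y%:R) ^+ 2 :> R by apply: sqr_ge0.
  have : 0 <= y%:R :> R by [].
  by rewrite /G sqrrB; move: pK; lra.
elim: l d rho sigma => [|tau l IH] d rho sigma lS rhoS sp rt served.
  have := @served_ge_G t d rho sigma rt sp.
  have h0 : (0 < d)%N -> t%:R <= sigma 0%N.
    by move=> d0; have [[? //]|] := served _ d0; lra.
  by move=> /(_ h0); have := young d; rewrite /=; lra.
have [|y yd Py] := @antitone_prefix (fun i => (rho i)%:R <= tau) d.
  move=> i j ijd; apply: le_trans; rewrite ler_nat; exact: rhoS.
have [z dE] : exists z, d = (y + z)%N by exists (d - y)%N; rewrite subnKC.
move: lS; rewrite /= lt_path_sortedE => /andP[/allP tauM lS].
(* The first group consists of the jobs released by the earliest replenishment [tau]. Its first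
   start is at least [tau] or at least [t + 1], hence not before any of these release dates. *)
have h1 : G y%:R <= \sum_(i < y) (sigma i + 1 - (rho i)%:R).
  apply: flow_ge_G; first exact: spaced_sub sp.
  move=> i iy; have id : (i < d)%N by apply: leq_trans yd.
  have d0 : (0 < d)%N by apply: leq_trans id.
  have [[tau' + /andP[_ h]]|h] := served _ d0.
    move=> tl; apply: le_trans h; apply: (@le_trans _ _ tau); first by rewrite Py.
    by move: tl; rewrite in_cons => /predU1P[->//|/tauM/ltW].
  have : (rho i)%:R <= t%:R :> R by rewrite ler_nat rt.
  lra.
have := IH z (fun i => rho (y + i)%N) (fun i => sigma (y + i)%N) lS.
have -> : \sum_(i < d) (sigma i + 1 - (rho i)%:R) =
  \sum_(i < y) (sigma i + 1 - (rho i)%:R) +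
  \sum_(i < z) (sigma (y + i)%N + 1 - (rho (y + i)%N)%:R).
  by rewrite dE (sum_ord_addn y z (fun i => sigma i + 1 - (rho i)%:R)).
have -> : p%:R * d%:R = p%:R * y%:R + p%:R * z%:R :> R by rewrite dE natrD mulrDr.
have -> : (size l).+1%:R + 1 = (size l)%:R + 1 + 1 :> R by rewrite -natr1.
move=> h; have := young y.
suff : p%:R * z%:R <= ((size l)%:R + 1) * K / 2 +
   \sum_(i < z) (sigma (y + i)%N + 1 - (rho (y + i)%N)%:R) by lra.
apply: h.
- by move=> i j /andP[ij jz]; apply: rhoS; rewrite dE leq_add2l ltn_add2l ij.
- by apply: spaced_shift; rewrite -dE.
- by move=> i iz; apply: rt; rewrite dE ltn_add2l.
(* Jobs released after [tau] cannot be served by it. *)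
- move=> i iz; have id : (y + i < d)%N by rewrite dE ltn_add2l.
  have [[tau' + h]|] := served _ id; last by right.
  rewrite in_cons => /predU1P[tE|tl]; last by left; exists tau'.
  by move: h; rewrite tE Py // -ltn_subRL subnn ltn0.
Qed.

(** The left-hand side of the algorithm's test; [batch_flowE] identifies it with the total flow time
    of [d] jobs run without idle time from [t]. *)
Definition batch_flow (t d : nat) rho : R :=
  \sum_(i < d) (t%:R - (rho i)%:R) + G d%:R.

Lemma batch_flowE t d rho :
  batch_flow t d rho = \sum_(i < d) (t%:R + i%:R + 1 - (rho i)%:R).
Proof.
rewrite /batch_flow -sum_succ -big_split /=; apply: eq_bigr => i _; lra.
Qed.

Lemma batch_flow_le t d rho sigma :
  spaced d sigma -> ((0 < d)%N -> t%:R <= sigma 0%N) ->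
  batch_flow t d rho <= \sum_(i < d) (sigma i + 1 - (rho i)%:R).
Proof.
move=> sp h; rewrite batch_flowE; apply: ler_sum => i _.
by have := spaced_ge sp h (ltn_ord i); lra.
Qed.

(** [small_backlog] refers to time [t - 1]; waiting until [t] costs one more unit per job. *)
Lemma batch_flow_pred t a rho :
  (forall i, (i < a)%N -> (rho i < t)%N) ->
  batch_flow t a rho = \sum_(i < a) (t.-1 - rho i)%:R + a%:R + G a%:R.
Proof.
move=> h; rewrite /batch_flow; congr (_ + _).
have -> : a%:R = \sum_(i < a) 1 :> R by rewrite sumr_const card_ord.
rewrite -big_split /=; apply: eq_bigr => i _.
have := h i (ltn_ord i); case: t {h} => // t; rewrite ltnS /= => it.
by rewrite natrB // -natr1; lra.
Qed.

(* The two situations in which the algorithm examines its backlog at time [t]: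
   it has just completed a batch, or it found the backlog of time [t - 1], that
   is the [a] jobs released before [t], too small. *)
Definition small_lead K (t d : nat) sigma :=
  exists2 p : nat, p%:R ^+ 2 <= K & forall i, (i < d)%N -> t%:R + i%:R - p%:R <= sigma i.

Definition small_backlog K (t a d : nat) rho :=
  [/\ (a <= d)%N, forall i, (i < d)%N -> (rho i < t)%N = (i < a)%N
    & \sum_(i < a) (t.-1 - rho i)%:R + G a%:R <= K].

Lemma batch_cost_busy K t l d rho sigma :
  0 <= K -> small_lead K t d sigma -> (0 < size l)%N ->
  sorted <%R l -> nondecreasing_upto d rho -> spaced d sigma ->
  (forall i, (i < d)%N -> (rho i <= t)%N) -> served_from l t d rho sigma ->
  batch_flow t d rho + K
    <= 2 * \sum_(i < d) (sigma i + 1 - (rho i)%:R) + 2 * (size l)%:R * K.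
Proof.
move=> K0 [p pK lead] l0 lS rhoS sp rt served.
have h := lead_le_flow pK lS rhoS sp rt served.
have : batch_flow t d rho <=
    \sum_(i < d) (sigma i + 1 - (rho i)%:R) + p%:R * d%:R.
  have -> : p%:R * d%:R = \sum_(i < d) p%:R :> R.
    by rewrite sumr_const card_ord mulr_natr.
  rewrite batch_flowE -big_split /=; apply: ler_sum => i _.
  by have := lead i (ltn_ord i); lra.
(* For [m = size l >= 1], the remaining [(m + 1) K / 2 + K] is at most [2 m K]. *)
have : K <= (size l)%:R * K by rewrite ler_peMl // ler1n.
lra.
Qed.

Lemma batch_cost_idle K t a l d rho sigma :
  0 <= K -> small_backlog K t a d rho -> (0 < size l)%N ->
  sorted <%R l -> nondecreasing_upto d rho -> spaced d sigma ->
  (forall i, (i < d)%N -> (rho i <= t)%N) -> served_from l t d rho sigma ->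
  batch_flow t d rho + K
    <= 2 * \sum_(i < d) (sigma i + 1 - (rho i)%:R) + 2 * (size l)%:R * K.
Proof.
move=> K0 [ad before aK] l0 lS rhoS sp rt served.
set O := \sum_(i < d) _.
have rho_sigma i : (i < d)%N -> (rho i)%:R <= sigma i.
  move=> id; have [[tau _ /andP[]]|] := served _ id; first exact: le_trans.
  by have : (rho i)%:R <= t%:R :> R by [rewrite ler_nat rt]; lra.
have O0 : 0 <= O.
  apply: sumr_ge0 => i _; have := rho_sigma i (ltn_ord i); lra.
have [x dE] : exists x, d = (a + x)%N by exists (d - a)%N; rewrite subnKC.
have rhoX i : (i < x)%N -> rho (a + i)%N = t.
  move=> ix; have id : (a + i < d)%N by rewrite dE ltn_add2l.
  apply/eqP; rewrite eqn_leq rt //= leqNgt before //.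
  by rewrite -ltn_subRL subnn ltn0.
have aE := @batch_flow_pred t a rho (fun i ia => etrans (before _ (leq_trans ia ad)) ia).
(* The [x] jobs released at [t] have not waited, and [G (a + x) = G a + a x + G x]. *)
have fE : batch_flow t d rho = batch_flow t a rho + a%:R * x%:R + G x%:R.
  rewrite /batch_flow dE (sum_ord_addn a x (fun i => t%:R - (rho i)%:R)).
  have -> : \sum_(i < x) (t%:R - (rho (a + i)%N)%:R) = 0 :> R.
    by rewrite big1 // => i _; rewrite rhoX // subrr.
  by rewrite /G natrD; field.
set A : R := a%:R; set X : R := x%:R.
have f_le : batch_flow t d rho <= K + A + A * X + G X by rewrite fE aE -/A -/X; lra.
have GaK : G A <= K.
  apply: le_trans aK; rewrite lerDr; apply: sumr_ge0 => i _; exact: ler0n.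
have A0 : 0 <= A by []. have X0 : 0 <= X by [].
have mean : 0 <= (A - X) ^+ 2 by exact: sqr_ge0.
(* Two replenishments leave enough room for the crude bound [O >= a + G x], since
   [a x <= G a + G x <= K + G x]. A single one needs a finer bound on [O]. *)
move: l0 lS served; case: l => [|tau [|tau' l]] // _ lS served; last first.
  have O_ge : A + G X <= O.
    rewrite /O dE (sum_ord_addn a x (fun i => sigma i + 1 - (rho i)%:R)); apply: lerD.
      have -> : A = \sum_(i < a) 1 by rewrite sumr_const card_ord.
      apply: ler_sum => i _; have := rho_sigma i (leq_trans (ltn_ord i) ad); lra.
    apply: (@flow_ge_G x (fun i => rho (a + i)%N) (fun i => sigma (a + i)%N)).
      by apply: spaced_shift; rewrite -dE.
    move=> i ix; rewrite rhoX // -(rhoX 0%N) ?(leq_trans _ ix) // addn0.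
    by apply: rho_sigma; rewrite dE -addn1 leq_add2l (leq_trans _ ix).
  have : 2 * K <= (size (tau :: tau' :: l))%:R * K.
    by rewrite ler_wpM2r // ler_nat.
  move: mean f_le GaK O_ge; rewrite /G sqrrB => *; nra.
rewrite mulr1.
have [tle|taut] := lerP t%:R tau.
  have := @batch_flow_le t d rho sigma sp.
  suff h0 : (0 < d)%N -> t%:R <= sigma 0%N by rewrite -/O => /(_ h0); lra.
  move=> d0.
  have [[tau' + /andP[_ h]]|] := served _ d0; last by lra.
  by rewrite inE => /eqP tE; rewrite tE in h; exact: le_trans h.
have [|y yd Py] := @antitone_prefix (fun i => (rho i)%:R <= tau) d.
  move=> i j ijd; apply: le_trans; rewrite ler_nat; exact: rhoS.
have ya : (y <= a)%N.
  rewrite leqNgt; apply/negP => ay; have ad' : (a < d)%N by apply: leq_trans yd.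
  have : (rho a < t)%N.
    by rewrite -(ltr_nat R); apply: le_lt_trans taut; rewrite Py.
  by rewrite before // ltnn.
have [q aE'] : exists q, a = (y + q)%N by exists (a - y)%N; rewrite subnKC.
have dE' : d = (y + (q + x))%N by rewrite dE aE' addnA.
set Y : R := y%:R; set Q : R := q%:R.
(* The single [tau < t] can serve only the [y] jobs released by then; the other [q + x] start at
   [t + 1] or later. As [2 G (q + x)] contains [2 q x], only the cross term [y x] needs the
   squares. *)
have O_ge : G Y + G (Q + X) <= O.
  rewrite /O dE' (sum_ord_addn y (q + x) (fun i => sigma i + 1 - (rho i)%:R)); apply: lerD.
    apply: flow_ge_G; first exact: spaced_sub sp.
    move=> i iy; have id : (i < d)%N by apply: leq_trans yd.
    have d0 : (0 < d)%N by apply: leq_trans id.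
    have [[tau' + /andP[_ h]]|h] := served _ d0.
      by rewrite inE => /eqP tE; rewrite tE in h; apply: le_trans h; rewrite Py.
    by have : (rho i)%:R <= t%:R :> R by [rewrite ler_nat rt]; lra.
  rewrite -natrD.
  apply: (@served_ge_G t (q + x) (fun i => rho (y + i)%N) (fun i => sigma (y + i)%N)).
  - by move=> i iz; apply: rt; rewrite dE' ltn_add2l.
  - by apply: spaced_shift; rewrite -dE'.
  - move=> d0; rewrite addn0.
    have yd' : (y < d)%N by rewrite dE' -addn1 leq_add2l.
    have [[tau' + /andP[h _]]|] := served _ yd'; last by lra.
    by rewrite inE => /eqP tE; rewrite tE Py // ltnn in h.
have AE : A = Y + Q by rewrite /A aE' natrD.
have Y0 : 0 <= Y by []. have Q0 : 0 <= Q by [].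
have QX : 0 <= Q * X by exact: mulr_ge0.
have mean' : 0 <= (Y - X) ^+ 2 by exact: sqr_ge0.
move: f_le O_ge mean'; rewrite AE /G sqrrB => *; nra.
Qed.

Lemma batch_cost K t l d rho sigma :
  0 <= K -> K <= batch_flow t d rho ->
  small_lead K t d sigma \/ (exists a, small_backlog K t a d rho) ->
  sorted <%R l -> nondecreasing_upto d rho -> spaced d sigma ->
  (forall i, (i < d)%N -> (rho i <= t)%N) -> served_from l t d rho sigma ->
  batch_flow t d rho + K
    <= 2 * \sum_(i < d) (sigma i + 1 - (rho i)%:R) + 2 * (size l)%:R * K.
Proof.
move=> K0 Kf state lS rhoS sp rt served.
case: (posnP (size l)) => [/size0nil lE|l0]; last first.
  case: state => [lead|[a small]]; first exact: batch_cost_busy.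
  exact: batch_cost_idle small _ _ _ _ _ _.
have : batch_flow t d rho <= \sum_(i < d) (sigma i + 1 - (rho i)%:R).
  apply: batch_flow_le => // d0.
  by have [[tau]|] := served _ d0; [rewrite lE | lra].
rewrite lE /= mulr0 mul0r; lra.
Qed.

(* If [p] jobs of the backlog are started before [t], the [i]-th of them
   (counting from 0) has [rho i <= t - (p - i)]; and [G (p - 1) + G p = p ^ 2]. *)
Lemma small_backlog_lead K t a d rho sigma :
  small_backlog K t a d rho -> spaced d sigma ->
  (forall i, (i < d)%N -> (rho i)%:R <= sigma i) ->
  exists p : nat, [/\ (p <= a)%N, p%:R ^+ 2 <= K
    & forall i, (p <= i < d)%N -> t%:R + i%:R - p%:R <= sigma i].
Proof.
move=> [ad before aK] sp rs.
have [|p pd Pp] := @antitone_prefix (fun i => sigma i < t%:R) d.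
  move=> i j ijd; apply: le_lt_trans; have := sp _ _ ijd.
  by have : 0 <= (j - i)%:R :> R by []; lra.
(* Starts are one unit apart, so job [i] is released at least [p - 1 - i] units before
   [sigma (p - 1) < t]. *)
have rho_lt i : (i < p)%N -> (rho i + (p.-1 - i) < t)%N.
  move=> ip; have p1d : (p.-1 < d)%N by rewrite prednK ?(leq_trans _ ip).
  have ip1 : (i <= p.-1)%N by rewrite -ltnS prednK // (leq_trans _ ip).
  have h : sigma p.-1 < t%:R by rewrite Pp // prednK // (leq_trans _ ip).
  rewrite -(ltr_nat R) natrD; apply: le_lt_trans h.
  have := sp i p.-1; rewrite ip1 p1d => /(_ isT).
  have := rs i (leq_trans ip pd); lra.
have pa : (p <= a)%N.
  rewrite leqNgt; apply/negP => ap; have ad' := leq_trans ap pd.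
  have := rho_lt _ ap; rewrite ltnNge => /negP; apply.
  by rewrite (leq_trans _ (leq_addr _ _)) // leqNgt before // ltnn.
exists p; split=> //; last first.
  move=> i /andP[ip id]; have pd' : (p < d)%N by apply: leq_ltn_trans id.
  have : t%:R <= sigma p by rewrite leNgt Pp // ltnn.
  by have := sp p i; rewrite ip id natrB // => /(_ isT); lra.
apply: le_trans aK; have [x aE] : exists x, a = (p + x)%N by exists (a - p)%N; rewrite subnKC.
have h1 : \sum_(i < p) (p.-1 - i)%:R <= \sum_(i < a) (t.-1 - rho i)%:R :> R.
  rewrite aE (sum_ord_addn p x (fun i => (t.-1 - rho i)%:R)).
  rewrite -[X in X <= _]addr0; apply: lerD; last by apply: sumr_ge0 => i _; exact: ler0n.
  by apply: ler_sum => i _; rewrite ler_nat; have := rho_lt i (ltn_ord i); lia.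
(* This is [G (p - 1)], in a form that adds up with [G p <= G a] to [p ^ 2]. *)
have h2 : \sum_(i < p) (p.-1 - i)%:R = p%:R ^+ 2 - G p%:R :> R.
  rewrite -(sum_succ p).
  transitivity (\sum_(i < p) (p%:R - (i%:R + 1)) : R).
    apply: eq_bigr => i _; rewrite natrB; last by have := ltn_ord i; lia.
    have p0 : (0 < p)%N by apply: leq_trans (ltn_ord i).
    have : p%:R = p.-1%:R + 1 :> R by rewrite natr1 prednK.
    lra.
  by rewrite sumrB sumr_const card_ord -[X in X - _]mulr_natr expr2.
have : G p%:R <= G a%:R :> R.
  rewrite /G ler_pM2r ?invr_gt0 ?ltr0n //.
  by have : p%:R <= a%:R :> R by [rewrite ler_nat]; have : 0 <= p%:R :> R by []; nra.
lra.
Qed.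

End Batch.

(** * Schedules in release order *)

Section ReleaseOrder.
Variables (n : nat) (r : 'I_n -> nat).

(** A stable sort with the same tie-breaking as in the algorithm, so that each batch is a segment of
    this list. *)
Definition by_release : seq 'I_n := sort (relpre r leq) (enum 'I_n).

Definition nth_release (k : nat) : nat := nth 0%N [seq r j | j <- by_release] k.

Lemma perm_by_release : perm_eq by_release (enum 'I_n).
Proof. by rewrite perm_sort. Qed.

Lemma uniq_by_release : uniq by_release.
Proof. by rewrite sort_uniq enum_uniq. Qed.

Lemma size_by_release : size by_release = n.
Proof. by rewrite size_sort size_enum_ord. Qed.

Lemma mem_by_release j : j \in by_release.
Proof. by rewrite mem_sort mem_enum. Qed.

Lemma nth_release_index j : nth_release (index j by_release) = r j.
Proof. by rewrite /nth_release (nth_map j) ?nth_index ?index_mem ?mem_by_release. Qed.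

Lemma nth_release_nondecreasing : nondecreasing_upto n nth_release.
Proof.
move=> i j /andP[ij jn]; apply: (sorted_leq_nth leq_trans leqnn) => //.
- rewrite sorted_map; apply: sort_sorted => x y; exact: leq_total.
- by rewrite inE size_map size_by_release (leq_ltn_trans ij).
- by rewrite inE size_map size_by_release.
Qed.

Lemma sum_nth_perm (R : realType) (e : seq 'I_n) (F : 'I_n -> R) :
  perm_eq e (enum 'I_n) ->
  \sum_(j < n) F j = \sum_(k < n) nth 0 [seq F j | j <- e] k.
Proof.
move=> pe; have se : size e = n by rewrite (perm_size pe) size_enum_ord.
rewrite -[LHS]big_enum -(perm_big _ pe) /= -(big_map F predT id).
by rewrite (big_nth 0) size_map se big_mkord.
Qed.

(** Starts and release dates enter the total flow time through separate sums, so each may be listed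
    in its own order. *)
Lemma sum_flow_nth (R : realType) (e : seq 'I_n) (S : 'I_n -> R) :
  perm_eq e (enum 'I_n) ->
  \sum_(j < n) (S j + 1 - (r j)%:R) =
  \sum_(k < n) (nth 0 [seq S j | j <- e] k + 1 - (nth_release k)%:R).
Proof.
move=> pe; rewrite !big_split /= (sum_nth_perm _ pe); congr (_ + _).
rewrite (sum_nth_perm _ perm_by_release); apply: eq_bigr => k _.
have kn : (k < size by_release)%N by rewrite size_by_release.
by rewrite /nth_release !(nth_map k).
Qed.

(* Reassigning the start times in the order of the release dates keeps the
   total flow time, and the solution stays feasible: among the jobs with the
   [k + 1] first starts, one is not among the [k] first released. *)
Lemma feasible_fifo (R : realType) (s : solution R n) :
  feasible r s -> exists sigma : nat -> R,
  [/\ spaced n sigma,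
      forall k, (k < n)%N -> exists2 tau, tau \in replenishments s
        & (nth_release k)%:R <= tau <= sigma k
    & \sum_(j < n) flow_time r s j
      = \sum_(k < n) (sigma k + 1 - (nth_release k)%:R)].
Proof.
move=> [_ disj serv].
pose e := sort (relpre (start s) <=%R) (enum 'I_n).
have pe : perm_eq e (enum 'I_n) by rewrite perm_sort.
have se : size e = n by rewrite size_sort size_enum_ord.
have ue : uniq e by rewrite sort_uniq enum_uniq.
have eS : sorted <=%R [seq start s j | j <- e].
  by rewrite sorted_map; apply: sort_sorted => x y; exact: le_total.
pose sigma k := nth 0 [seq start s j | j <- e] k.
have sigma_le i j : (i <= j < n)%N -> sigma i <= sigma j.
  move=> /andP[ij jn]; apply: (sorted_leq_nth le_trans lexx) => //.
    by rewrite inE size_map se (leq_ltn_trans ij).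
  by rewrite inE size_map se.
have sigma_step i : (i.+1 < n)%N -> sigma i + 1 <= sigma i.+1.
  move=> iN; have iN' := ltnW iN; have := sigma_le i i.+1.
  rewrite leqnSn iN => /(_ isT).
  rewrite /sigma !(nth_map (Ordinal iN)) ?se //.
  set a := nth _ e i; set b := nth _ e i.+1.
  have ab : a != b by rewrite nth_uniq ?se // neq_ltn ltnSn.
  by have [] := disj _ _ ab; lra.
exists sigma; split.
- move=> i j /andP[ij jn].
  elim: j ij jn => [|j IH].
    by rewrite leqn0 => /eqP -> _; rewrite subnn addr0.
  rewrite leq_eqVlt => /predU1P[->|]; first by rewrite subnn addr0.
  rewrite ltnS => ij jn; have := IH ij (ltnW jn); have := sigma_step _ jn.
  by rewrite subSn // -natr1; lra.
- move=> k kn.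
  (* Pigeonhole: [j] is released no earlier than [nth_release k] and started no later than
     [sigma k], so its replenishment serves position [k]. *)
  have /subsetPn[j] : ~~ ([set x in take k.+1 e] \subset [set x in take k by_release]).
    apply/negP => /subset_leq_card; rewrite !cardsE.
    rewrite !(card_uniqP _) ?take_uniq ?uniq_by_release //.
    by rewrite !size_takel ?se ?size_by_release ?ltnn // ltnW.
  rewrite !inE => je; rewrite in_take ?mem_by_release // -leqNgt => kj.
  have [tau tauIn /andP[rt ts]] := serv j; exists tau => //.
  apply/andP; split.
    apply: le_trans rt; rewrite ler_nat -(nth_release_index j).
    apply: nth_release_nondecreasing; rewrite kj.
    by rewrite -{2}size_by_release index_mem mem_by_release.
  apply: le_trans ts _; have jE : j \in e by rewrite mem_sort mem_enum.
  have -> : start s j = sigma (index j e).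
    by rewrite /sigma (nth_map j) ?nth_index ?index_mem.
  by apply: sigma_le; rewrite kn andbT -ltnS -in_take.
- exact: sum_flow_nth.
Qed.

End ReleaseOrder.

(** * Invariants and termination of the run *)

Section Run.
Variables (R : realType) (K : R) (n : nat) (r : 'I_n -> nat).
Hypothesis K_ge0 : 0 <= K.
Local Notation e := (by_release r).
Local Notation rel := (nth_release r).
Local Notation A := (Online_SumFj K).

(** Started jobs and released jobs are both prefixes of [by_release], and sorting commutes with
    filtering: the backlog is the segment between them. *)
Lemma sort_backlog L c b :
  unzip1 (started L) = [seq val j | j <- take c e] ->
  (forall k, (k < n)%N -> (rel k <= clock L)%N = (k < c + b)%N) ->
  sort (fun i j => (i.2 <= j.2)%N) (backlog (released r (clock L)) L)
  = [seq (val j, r j) | j <- take b (drop c e)].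
Proof.
move=> jobs known; rewrite /backlog /released filter_map sort_map.
set q := preim _ _; rewrite -filter_predI.
rewrite -filter_sort; last 2 first.
- by move=> x y; exact: leq_total.
- by move=> x y z; exact: leq_trans.
congr map.
have -> : take b (drop c e) = [seq x <- e | x \in take b (drop c e)].
  apply/subseq_uniqP; first exact: uniq_by_release.
  exact: subseq_trans (take_subseq _ _) (drop_subseq _ _).
apply: eq_in_filter => j je.
have jn : (index j e < n)%N by rewrite -[n in (_ < n)%N](size_by_release r) index_mem.
rewrite /= jobs mem_map; last exact: val_inj.
have -> : (r j <= clock L)%N = (j \in take (c + b) e).
  by rewrite in_take // -known // nth_release_index.
rewrite takeD mem_cat andb_orr andNb /=.
apply: andb_idl => jb; apply/negP => jc.
have := uniq_by_release r; rewrite -(cat_take_drop (c + b)%N e) takeD !cat_uniq.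
move=> /andP[/and3P[_ /hasPn h _] _].
by have := h _ jb; rewrite /= jc.
Qed.

Lemma Online_SumFjE L c b :
  (c + b <= n)%N ->
  unzip1 (started L) = [seq val j | j <- take c e] ->
  (forall k, (k < n)%N -> (rel k <= clock L)%N = (k < c + b)%N) ->
  A (released r (clock L)) L =
  if (0 < b)%N && (K <= batch_flow R (clock L) b (fun i => rel (c + i)%N))
  then (true, [seq val j | j <- take b (drop c e)]) else (false, [::]).
Proof.
move=> cb jobs known; rewrite /Online_SumFj.
have sE := sort_backlog jobs known.
set B := backlog _ _ in sE *.
have sb : size (take b (drop c e)) = b.
  by rewrite size_takel // size_drop size_by_release leq_subRL // (leq_trans (leq_addr _ _) cb).
have sB : size B = b.
  by have := congr1 size sE; rewrite size_sort size_map sb.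
have -> : (B != [::]) = (0 < b)%N by rewrite -size_eq0 sB lt0n.
have -> : \sum_(j <- B) ((clock L)%:R - j.2%:R) =
          \sum_(i < b) ((clock L)%:R - (rel (c + i)%N)%:R) :> R.
  rewrite -(perm_big _ (permEl (perm_sort (fun i j => (i.2 <= j.2)%N) B))) /= sE.
  rewrite big_map /= -(big_map r predT (fun x => (clock L)%:R - x%:R)).
  rewrite (big_nth 0%N) size_map sb big_mkord; apply: eq_bigr => i _.
  by rewrite map_take map_drop nth_take // nth_drop.
by rewrite sB sE /unzip1 -map_comp.
Qed.

(** Along the run, [c] counts the started jobs and [w] is the successor of the last replenishment
    time, or 0 before any. [inv_released] persists because a batch takes every job known at its
    start. *)
Record run_invariant (L : log) (c w : nat) : Prop := RunInvariant {
  inv_le : (c <= n)%N;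
  inv_jobs : unzip1 (started L) = [seq val j | j <- take c e];
  inv_released : forall k, (k < n)%N -> (rel k < w)%N = (k < c)%N;
  inv_window : (w <= clock L)%N;
  inv_starts : sorted ltn (unzip2 (started L));
  inv_starts_lt : all (ltn^~ (clock L)) (unzip2 (started L));
  inv_replenished : sorted ltn (replenished L);
  inv_replenished_lt : all (ltn^~ w) (replenished L);
  inv_served : forall k, (k < c)%N -> exists2 u, u \in replenished L
    & (rel k <= u <= nth 0 (unzip2 (started L)) k)%N
}.

Lemma run_invariant_size L c w : run_invariant L c w -> size (started L) = c.
Proof.
move=> inv; have := congr1 size (inv_jobs inv).
by rewrite !size_map size_takel // size_by_release (inv_le inv).
Qed.

Lemma sorted_cat_iota s t b :
  sorted ltn s -> all (ltn^~ t) s -> sorted ltn (s ++ iota t b).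
Proof.
move=> sS /allP st; rewrite !(sorted_pairwise ltn_trans) pairwise_cat.
rewrite -!(sorted_pairwise ltn_trans) sS iota_ltn_sorted !andbT.
apply/allrelP => x y /st xt; rewrite mem_iota => /andP[ty _].
exact: leq_trans xt ty.
Qed.

Variant advance_spec (L : log) (c w b : nat) : Prop :=
  | AdvanceBatch of (0 < b)%N
      & K <= batch_flow R (clock L) b (fun i => rel (c + i)%N)
      & advance A r L
        = Log (clock L + b)
              (started L ++ zip [seq val j | j <- take b (drop c e)] (iota (clock L) b))
              (rcons (replenished L) (clock L))
      & run_invariant (advance A r L) (c + b) (clock L).+1
  | AdvanceIdle of ~~ ((0 < b)%N && (K <= batch_flow R (clock L) b (fun i => rel (c + i)%N)))
      & advance A r L = Log (clock L).+1 (started L) (replenished L)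
      & run_invariant (advance A r L) c w.

Lemma advanceP L c w : run_invariant L c w -> exists b,
  [/\ (c + b <= n)%N,
      forall k, (k < n)%N -> (rel k <= clock L)%N = (k < c + b)%N
    & advance_spec L c w b].
Proof.
move=> inv; have [cn jobs relw wt sS /allP st repS /allP rept serv] := inv.
have [|y yn Py] := @antitone_prefix (fun k => (rel k <= clock L)%N) n.
  by move=> i j ijn; apply: leq_trans; exact: nth_release_nondecreasing.
have cy : (c <= y)%N.
  case: c cn relw {jobs serv inv} => // c cn relw; rewrite -Py //.
  by apply: leq_trans wt; apply: ltnW; rewrite relw.
have [b yE] : exists b, y = (c + b)%N by exists (y - c)%N; rewrite subnKC.
rewrite {}yE in yn cy Py; exists b; split=> //.
have sc : size (started L) = c := run_invariant_size inv.
have sb : size (take b (drop c e)) = b.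
  by rewrite size_takel // size_drop size_by_release leq_subRL.
have AE := Online_SumFjE yn jobs Py.
have adv : advance A r L =
  if (0 < b)%N && (K <= batch_flow R (clock L) b (fun i => rel (c + i)%N)) then
  Log (clock L + b)
              (started L ++ zip [seq val j | j <- take b (drop c e)] (iota (clock L) b))
              (rcons (replenished L) (clock L))
  else Log (clock L).+1 (started L) (replenished L).
  rewrite /advance AE; case: ifP => [/andP[b0 _]|_] /=.
    by rewrite size_map sb (maxn_idPr b0).
  by rewrite cats0 addn1.
case: ifP adv => [/andP[b0 Kf]|/negbT small] adv; last first.
  apply: AdvanceIdle => //; rewrite adv; split=> //=.
  - exact: leqW.
  - by apply/allP => x /st /= xt; exact: leqW.
  - exact/allP.
apply: (@AdvanceBatch L c w b b0 Kf adv); rewrite adv.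
have zsize : size [seq val j | j <- take b (drop c e)] = size (iota (clock L) b).
  by rewrite size_map size_iota.
have u2 : unzip2 (started L ++ zip [seq val j | j <- take b (drop c e)] (iota (clock L) b))
          = unzip2 (started L) ++ iota (clock L) b.
  by rewrite /unzip2 map_cat -/(unzip2 (zip _ _)) unzip2_zip // zsize.
split; rewrite /= ?u2 //.
- rewrite /unzip1 map_cat -/(unzip1 (zip _ _)) -/(unzip1 (started L)).
  by rewrite unzip1_zip ?zsize // jobs -map_cat -takeD.
- by rewrite -addn1 leq_add2l.
- by apply: sorted_cat_iota => //; apply/allP.
- apply/allP => x; rewrite mem_cat mem_iota => /orP[/st /= xt|/andP[] //].
  exact: leq_trans xt (leq_addr _ _).
- rewrite -cats1 -/(iota (clock L) 1); apply: sorted_cat_iota => //.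
  by apply/allP => x /rept /= xt; exact: leq_trans xt wt.
- apply/allP => x; rewrite mem_rcons inE => /predU1P[->//|/rept /= xt].
  by apply: leq_trans xt _; exact: leqW.
- move=> k kcb; rewrite nth_cat size_map sc.
  have [kc|ck] := ltnP k c.
    by have [u uin h] := serv _ kc; exists u; rewrite // mem_rcons inE uin orbT.
  exists (clock L); first by rewrite mem_rcons inE eqxx.
  rewrite Py ?kcb ?(leq_trans kcb) //= nth_iota ?leq_addr //.
  by rewrite ltn_subLR.
Qed.

Lemma run_clock_ge N : (N <= clock (run A r N))%N.
Proof.
elim: N => // N IH; rewrite /run iterS -/(run A r N) /= -addn1.
by apply: leq_add => //; exact: leq_maxl.
Qed.

Lemma run0_invariant : run_invariant (run A r 0) 0 0.
Proof. by split=> //=; rewrite take0. Qed.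

Lemma run_invariantP N : exists c w, run_invariant (run A r N) c w.
Proof.
elim: N => [|N [c [w inv]]]; first by exists 0%N, 0%N; exact: run0_invariant.
have [b [_ _ [_ _ _ inv'|_ _ inv']]] := advanceP inv; rewrite /run iterS.
  by exists (c + b)%N, (clock (run A r N)).+1.
by exists c, w.
Qed.

(* Once the clock exceeds all release dates by [K], every backlog is processed
   at once. *)
Lemma run_complete : exists N w, run_invariant (run A r N) n w.
Proof.
pose N0 := (\max_(j < n) r j + Num.bound K)%N.
(* From iteration [N0] on, each iteration starts at least one job while any is left. *)
suff h m : exists c w, run_invariant (run A r (N0 + m)) c w /\ (minn m n <= c)%N.
  have [c [w [inv]]] := h n; rewrite minnn => nc.
  have cE : c = n by apply/eqP; rewrite eqn_leq nc (inv_le inv).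
  by exists (N0 + n)%N, w; rewrite cE in inv.
elim: m => [|m [c [w [inv mc]]]].
  by have [c [w inv]] := run_invariantP (N0 + 0); exists c, w; rewrite min0n.
rewrite addnS /run iterS -/(run A r (N0 + m)).
have [b [cbn known [b0 _ _ inv'|small _ inv']]] := advanceP inv.
  exists (c + b)%N, (clock (run A r (N0 + m))).+1; split=> //; lia.
exists c, w; split=> //.
have [cn|] := ltnP c n; last by lia.
have relc : (rel c + Num.bound K <= clock (run A r (N0 + m)))%N.
  apply: leq_trans (run_clock_ge _); apply: leq_trans (leq_addr _ _).
  rewrite leq_add2r /nth_release (nth_map (Ordinal cn)) ?size_by_release //.
  exact: (leq_bigmax (nth (Ordinal cn) e c)).
have b0 : (0 < b)%N.
  by rewrite -[b]addn0 -(ltn_add2l c) addn0 addn0 -known // (leq_trans _ relc) // leq_addr.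
case/negP: small; rewrite b0 /= /batch_flow; set t := clock _ in relc known *.
case: b b0 cbn known {inv'} => // b _ cbn known.
(* The first job of the backlog alone has waited [Num.bound K] or more, which exceeds [K]. *)
rewrite big_ord_recl addn0.
have := archi_boundP K_ge0; have := G_ge0 R b.+1.
have : (rel c)%:R + (Num.bound K)%:R <= t%:R :> R by rewrite -natrD ler_nat.
have : 0 <= \sum_(i < b) (t%:R - (rel (c + bump 0 i)%N)%:R) :> R.
  apply: sumr_ge0 => i _; rewrite subr_ge0 ler_nat known ?ltn_add2l ?ltnS //.
  by apply: leq_trans cbn; rewrite ltn_add2l /bump ltnS.
lra.
Qed.

Lemma run_settled N w : run_invariant (run A r N) n w -> settled A r N.
Proof.
move=> inv m /subnKC <-.
suff [? ? _] : [/\ started (run A r (N + (m - N))) = started (run A r N),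
  replenished (run A r (N + (m - N))) = replenished (run A r N)
  & run_invariant (run A r (N + (m - N))) n w] by [].
elim: (m - N)%N => [|d [IH1 IH2 IH3]]; first by rewrite addn0.
have [b [cbn _ [b0 _ _ _|_ advE inv']]] := advanceP IH3; first by lia.
by rewrite addnS /run iterS; split; rewrite // advE.
Qed.

(** * Feasibility and cost of the computed solution *)

Section Start.
Variables (L : log) (w : nat).
Hypothesis inv : run_invariant L n w.

Let take_all : take n e = e.
Proof. by apply: take_oversize; rewrite size_by_release. Qed.

Lemma complete_run : complete n L.
Proof.
move=> j; rewrite (inv_jobs inv) take_all mem_map; last exact: val_inj.
exact: mem_by_release.
Qed.

Lemma start_solution_of j :
  start (solution_of R n L) j = (nth 0%N (unzip2 (started L)) (index j e))%:R.
Proof.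
rewrite /= (inv_jobs inv) take_all index_map //; exact: val_inj.
Qed.

Lemma feasible_run : feasible r (solution_of R n L).
Proof.
have sz : size (unzip2 (started L)) = n by rewrite size_map (run_invariant_size inv).
have idx j : (index j e < n)%N.
  by rewrite -[X in (_ < X)%N](size_by_release r) index_mem mem_by_release.
split.
- rewrite /= sorted_map; apply: sub_sorted (inv_replenished inv) => x y.
  by rewrite /= ltr_nat.
- suff h i j : (index i e < index j e)%N ->
      start (solution_of R n L) i + 1 <= start (solution_of R n L) j.
    move=> i j ij; have : index i e != index j e.
      by apply: contra ij => /eqP /index_inj -> //; exact: mem_by_release.
    by rewrite neq_ltn => /orP[/h|/h]; [left | right].
  move=> ij; rewrite !start_solution_of natr1 ler_nat.
  by apply: (sorted_ltn_nth ltn_trans) => //; rewrite ?inE ?sz; try exact: idx; exact: inv_starts inv.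
- move=> j; have [u uin /andP[ru us]] := inv_served inv (idx j).
  exists u%:R; first by apply: map_f.
  by rewrite start_solution_of !ler_nat us andbT -(nth_release_index r j).
Qed.

Lemma cost_run : cost K r (solution_of R n L) =
  \sum_(k < n) ((nth 0%N (unzip2 (started L)) k)%:R + 1 - (rel k)%:R)
  + (size (replenished L))%:R * K.
Proof.
rewrite /cost /flow_time /completion size_map; congr (_ + _).
rewrite (sum_flow_nth _ _ (perm_by_release r)); apply: eq_bigr => k _; congr (_ + _ - _).
rewrite (nth_map k) ?size_by_release // start_solution_of.
by rewrite index_uniq ?size_by_release ?uniq_by_release.
Qed.

End Start.

(** * Amortized comparison along the run *)

Section Opt.
Variables (sigma : nat -> R) (taus : seq R).
Hypotheses (tausS : sorted <%R taus) (sp : spaced n sigma).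
Hypothesis serv : forall k, (k < n)%N ->
  exists2 tau, tau \in taus & (rel k)%:R <= tau <= sigma k.

(** Only replenishments before [w] are charged, so that each batch pays with those of its own window
    [[w, t + 1)]. *)
Definition cost_invariant (L : log) (c w : nat) : Prop :=
  \sum_(k < c) ((nth 0%N (unzip2 (started L)) k)%:R + 1 - (rel k)%:R)
    + (size (replenished L))%:R * K
  <= 2 * \sum_(k < c) (sigma k + 1 - (rel k)%:R)
    + 2 * (count (fun tau : R => tau < w%:R) taus)%:R * K.

Definition lead_invariant (L : log) (c : nat) : Prop :=
  small_lead K (clock L) (n - c) (fun i => sigma (c + i)%N) \/
  exists a, small_backlog K (clock L) a (n - c) (fun i => rel (c + i)%N).

(** The bound of [small_backlog_lead] holds from position [p] on; as [p <= a <= b], it covers all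
    jobs left after the batch. *)
Lemma lead_batch (t c b a : nat) :
  (c <= n)%N -> (a <= b)%N -> small_backlog K t a (n - c) (fun i => rel (c + i)%N) ->
  small_lead K (t + b) (n - (c + b)) (fun i => sigma (c + b + i)%N).
Proof.
move=> cn ab small.
have spc : spaced (n - c) (fun i => sigma (c + i)%N).
  by apply: spaced_shift; rewrite subnKC.
have [|p [pa pK lead]] := small_backlog_lead small spc.
  move=> i i_lt; have [|tau _ /andP[]] := serv (k := (c + i)%N); first by lia.
  exact: le_trans.
exists p => // i i_lt; rewrite -addnA.
have := lead (b + i)%N; rewrite natrD => /(_ _); rewrite natrD.
have -> : (p <= b + i < n - c)%N by lia.
by move=> /(_ isT); lra.
Qed.

Lemma count_window (w t : nat) : (w <= t)%N ->
  count (fun tau : R => tau < t.+1%:R) taus =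
  addn (count (fun tau : R => tau < w%:R) taus)
       (size [seq tau <- taus | w%:R <= tau < t.+1%:R]).
Proof.
move=> wt; rewrite size_filter; elim: (taus) => //= tau s ->.
suff -> : nat_of_bool (tau < t.+1%:R)%R = addn (tau < w%:R)%R (w%:R <= tau < t.+1%:R)%R.
  by rewrite addnACA.
have [tw|//] := ltP tau w%:R; rewrite (lt_trans tw) // ltr_nat.
by rewrite ltnS.
Qed.

Lemma advance_cost L c w :
  run_invariant L c w -> cost_invariant L c w -> lead_invariant L c ->
  exists c' w', [/\ run_invariant (advance A r L) c' w',
    cost_invariant (advance A r L) c' w' & lead_invariant (advance A r L) c'].
Proof.
move=> inv costL leadL.
have [b [cbn known [b0 Kf advE inv'|small advE inv']]] := advanceP inv; last first.
  exists c, w; split=> //; first by rewrite /cost_invariant advE.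
  (* The rejected backlog is, at the next clock value, the set of unstarted jobs released
     earlier. *)
  right; exists b; rewrite advE; split=> /=; first by lia.
    by move=> i i_lt; rewrite ltnS known ?ltn_add2l //; lia.
  move: small; case: (posnP b) => [->|b0] /=.
    by rewrite big_ord0 /G !mul0r addr0.
  rewrite -ltNge => /ltW; apply: le_trans; rewrite /batch_flow lerD2r.
  apply: ler_sum => i _; rewrite natrB // known ?ltn_add2l //.
  by apply: leq_trans cbn; rewrite ltn_add2l.
exists (c + b)%N, (clock L).+1; split=> //.
- have sc := run_invariant_size inv.
  set t := clock L in Kf advE inv' known *.
  pose l := [seq tau <- taus | w%:R <= tau < t.+1%:R].
  have wt : (w <= t)%N := inv_window inv.
  have bound : batch_flow R t b (fun i => rel (c + i)%N) + K <=
      2 * \sum_(i < b) (sigma (c + i)%N + 1 - (rel (c + i)%N)%:R)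
      + 2 * (size l)%:R * K.
    apply: (@batch_cost R K t l b (fun i => rel (c + i)%N) (fun i => sigma (c + i)%N)) => //.
    - case: leadL => [[p pK lead]|[a [ad before aK]]].
        left; exists p => // i ib; apply: lead; lia.
      right; exists a; split=> //.
        rewrite leqNgt; apply/negP => ba.
        have /before : (b < n - c)%N by lia.
        rewrite ba => /ltnW; rewrite known ?ltnn //; lia.
      by move=> i ib; apply: before; lia.
    - exact: sorted_filter lt_trans _ _ tausS.
    - move=> i j /andP[ij jb]; apply: nth_release_nondecreasing.
      by rewrite leq_add2l ij (leq_trans _ cbn) // ltn_add2l.
    - by apply: spaced_shift; apply: spaced_sub sp.
    - by move=> i ib; rewrite known ?ltn_add2l // (leq_trans _ cbn) // ltn_add2l.
    - move=> i ib; have cin : (c + i < n)%N by rewrite (leq_trans _ cbn) // ltn_add2l.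
      have [tau tauIn /andP[rt ts]] := serv cin.
      (* A job outside the first [c] is released at [w] or later, so its replenishment lies in the
         window or comes at [t + 1] or later. *)
      have [tt|] := ltP tau t.+1%:R; last first.
        by rewrite -natr1 => tt; right; exact: le_trans ts.
      left; exists tau; last by rewrite rt.
      rewrite mem_filter tauIn tt !andbT; apply: le_trans rt; rewrite ler_nat.
      by rewrite leqNgt (inv_released inv) // -ltn_subRL subnn ltn0.
  rewrite /cost_invariant advE /= size_rcons (count_window wt) -/l natrD -natr1.
  rewrite (sum_ord_addn c b (fun k => sigma k + 1 - (rel k)%:R)).
  rewrite /unzip2 map_cat -/(unzip2 (zip _ _)) -/(unzip2 (started L)) unzip2_zip; last first.
    rewrite size_iota size_map size_takel // size_drop size_by_release.
    by rewrite leq_subRL // (inv_le inv).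
  rewrite (sum_ord_addn c b (fun k =>
    (nth 0%N (unzip2 (started L) ++ iota t b) k)%:R + 1 - (rel k)%:R)).
  have -> : \sum_(i < c) ((nth 0%N (unzip2 (started L) ++ iota t b) i)%:R + 1 - (rel i)%:R)
    = \sum_(i < c) ((nth 0%N (unzip2 (started L)) i)%:R + 1 - (rel i)%:R) :> R.
    by apply: eq_bigr => i _; rewrite nth_cat size_map sc ltn_ord.
  have -> : \sum_(i < b) ((nth 0%N (unzip2 (started L) ++ iota t b) (c + i)%N)%:R
      + 1 - (rel (c + i)%N)%:R) = batch_flow R t b (fun i => rel (c + i)%N).
    rewrite batch_flowE; apply: eq_bigr => i _.
    rewrite nth_cat size_map sc -ltn_subRL subnn ltn0 addKn nth_iota //.
    by rewrite natrD.
  move: costL; rewrite /cost_invariant; lra.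
- rewrite advE /=; left; case: leadL => [[p pK lead]|[a small]].
    exists p => // i i_lt; rewrite /= -addnA natrD.
    have := lead (b + i)%N; rewrite natrD => /(_ _).
    have -> : (b + i < n - c)%N by lia.
    by move=> /(_ isT); lra.
  apply: (lead_batch (inv_le inv) _ small).
  case: small => ad before aK; rewrite leqNgt; apply/negP => ba.
  have /before : (b < n - c)%N by lia.
  by rewrite ba => /ltnW; rewrite known ?ltnn //; lia.
Qed.

Lemma run_cost N : exists c w,
  run_invariant (run A r N) c w /\ cost_invariant (run A r N) c w.
Proof.
suff [c [w [? ? _]]] : exists c w, [/\ run_invariant (run A r N) c w,
  cost_invariant (run A r N) c w & lead_invariant (run A r N) c] by exists c, w.
elim: N => [|N [c [w [inv costN lead]]]]; last exact: advance_cost inv costN lead.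
exists 0%N, 0%N; split; first exact: run0_invariant.
  rewrite /cost_invariant /= !big_ord0 mul0r !(mulr0, add0r).
  by rewrite !mulr_ge0.
(* Nothing is released before time 0, so the run begins as after rejecting an empty backlog. *)
right; exists 0%N; split=> //=.
by rewrite big_ord0 /G !mul0r addr0.
Qed.

End Opt.

End Run.

(** * The competitive ratio *)

Lemma run_cost_le (R : realType) (K : R) (n : nat) (r : 'I_n -> nat)
    (N w : nat) (s : solution R n) :
  0 <= K -> run_invariant r (run (Online_SumFj K) r N) n w -> feasible r s ->
  cost K r (solution_of R n (run (Online_SumFj K) r N)) <= 2 * cost K r s.
Proof.
move=> K0 inv feas; have [sigma [sp serv flowE]] := feasible_fifo feas.
have [tausS _ _] := feas.
have [c [w' [inv' +]]] := run_cost K0 tausS sp serv N.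
have -> : c = n by rewrite -(run_invariant_size inv') (run_invariant_size inv).
rewrite /cost_invariant (cost_run K inv) /cost flowE => costN.
apply: le_trans costN _; rewrite mulrDr lerD2l -mulrA ler_pM2l // ler_wpM2r //.
by rewrite ler_nat count_size.
Qed.

Theorem theorem13 (R : realType) (K : R) (hK : 0 <= K) :
  competitive K 2 (Online_SumFj K).
Proof.
move=> n r; have [N [w inv]] := run_complete r hK.
have feas := feasible_run R inv.
exists (solution_of R n (run (Online_SumFj K) r N)); split=> //.
  exists N; split=> //; first exact: run_settled inv.
  exact: complete_run inv.
(* Half the algorithm's cost bounds every offline cost from below; the computed solution shows that
   the infimum is over a nonempty set. *)
rewrite mulrC -ler_pdivrMr //; apply: lb_le_inf.
  exists (cost K r (solution_of R n (run (Online_SumFj K) r N))).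
  by exists (solution_of R n (run (Online_SumFj K) r N)).
move=> _ [s feas_s <-]; rewrite ler_pdivrMr // mulrC.
exact: run_cost_le inv feas_s.
Qed.
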